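(* Let $p,q$ be distinct prime numbers and $G=\mathbb{Z}_p\times\mathbb{Z}_{pq}$. Then the spectrum of $\mathscr{P}(G)$ (as a multiset) consists of: 1. $-1$ with multiplicity $p^2q-p-4$; 2. $(p-1)q-1$ with multiplicity $p$; 3. the (four) roots, counted with multiplicity, of the polynomial $$\begin{aligned}&-x^4+(pq-4)x^3+(p^2q^2-p^2q-pq^2+3pq+p^2+q-7)x^2\\&+\big(-p^3(q-1)^2+3p^2q^2-5p^2q-pq^2+4p^2-q^2+pq+p+5q-8\big)x\\&-p^4(q-1)^2+3p^2q^2-6p^2q-pq^2+pq+4p^2-q^2+4q-4.\end{aligned}$$
   Context: For a finite group $G$, the power graph $\mathscr{P}(G)$ is the simple graph with vertex set $G$ in which two distinct vertices $x,y$ are adjacent iff $x=y^k$ or $y=x^k$ for some $k\in\mathbb{N}$. The spectrum of a graph is the multiset of eigenvalues of its adjacency matrix. The spectrum is the multiset union of the listed items (multiplicities add if values in different items coincide). *)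

(* Defs.v *)
From mathcomp Require Import all_boot all_order all_fingroup all_algebra.
From mathcomp Require Import boolp.

Set Implicit Arguments.
Unset Strict Implicit.
Unset Printing Implicit Defensive.

Import GRing.Theory.
Local Open Scope ring_scope.

Definition power_graph (gT : finGroupType) : rel gT := fun x y =>
  (x != y) &&
  `[< (exists k : nat, x = (y ^+ k)%g) \/ (exists k : nat, y = (x ^+ k)%g) >].

Lemma power_graph_irrefl (gT : finGroupType) : irreflexive (@power_graph gT).
Proof. by move=> x; rewrite /power_graph eqxx. Qed.

Lemma power_graph_sym (gT : finGroupType) : symmetric (@power_graph gT).
Proof.
move=> x y; rewrite /power_graph eq_sym; congr (_ && _).
by apply/asbool_equiv_eq; split=> -[] ?; [right | left | right | left].
Qed.

Definition adjacency_matrix (R : pzSemiRingType) (T : finType) (e : rel T) :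
    'M[R]_#|T| :=
  \matrix_(i, j) (e (enum_val i) (enum_val j))%:R.

(* The roots with multiplicity, in an unspecified order; no meaning is attached
   to the value at the zero polynomial. *)
Definition poly_roots (C : closedFieldType) (P : {poly C}) : seq C :=
  sval (closed_field_poly_normal P).

Lemma poly_rootsE (C : closedFieldType) (P : {poly C}) :
  P = lead_coef P *: \prod_(z <- poly_roots P) ('X - z%:P).
Proof. exact: (svalP (closed_field_poly_normal P)). Qed.

(* To be compared up to perm_eq. The matrix is real symmetric, so its
   eigenvalues in C are its real eigenvalues, with the same multiplicities. *)
Definition graph_spectrum (C : numClosedFieldType) (T : finType) (e : rel T) :
    seq C :=
  poly_roots (char_poly (adjacency_matrix C e)).

Definition quartic (R : comNzRingType) (p q : R) : {poly R} :=
  - 'X^4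
  + (p * q - 4) *: 'X^3
  + (p ^+ 2 * q ^+ 2 - p ^+ 2 * q - p * q ^+ 2 + 3 * p * q + p ^+ 2 + q - 7)
      *: 'X^2
  + (- p ^+ 3 * (q - 1) ^+ 2 + 3 * p ^+ 2 * q ^+ 2 - 5 * p ^+ 2 * q
     - p * q ^+ 2 + 4 * p ^+ 2 - q ^+ 2 + p * q + p + 5 * q - 8) *: 'X
  + (- p ^+ 4 * (q - 1) ^+ 2 + 3 * p ^+ 2 * q ^+ 2 - 6 * p ^+ 2 * q
     - p * q ^+ 2 + p * q + 4 * p ^+ 2 - q ^+ 2 + 4 * q - 4)%:P.

(* Main.v *)
Require Import Defs.
From mathcomp Require Import all_boot all_order all_fingroup all_algebra.
From mathcomp Require Import boolp ring zify.

(** Write G = F_p^2 * F_q. Whether x is a power of y depends only on the line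
    of F_p^2 spanned by the p-part of each element (if nonzero) and on whether
    their q-parts vanish. Hence A + 1 = S B, where S has p + 4 columns: one for
    each of the p + 1 lines and three more. Since
    y^(p+4) det (y - S B) = y^n det (y - B S), the eigenvalue -1 of A splits
    off with multiplicity n - (p + 4). The matrix B S is
    a scalar on the block of the lines and is constant along the lines
    elsewhere, so a Schur complement reduces its determinant to a 3 x 3 one,
    which splits off (p - 1) q - 1 with multiplicity p and leaves the quartic. *)

Import GRing.Theory.
Local Open Scope ring_scope.

(** * Determinants of block matrices *)

(** Column operations reduce [X] to y - AB, row operations to y - BA. The latter scale the last n
    rows by y, so nothing is divided by y. *)
Lemma det_scalar_sub_mulmxC (R : comPzRingType) m n (A : 'M[R]_(m, n))
    (B : 'M[R]_(n, m)) (y : R) :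
  y ^+ n * \det (y%:M - A *m B) = y ^+ m * \det (y%:M - B *m A).
Proof.
pose X := block_mx y%:M A B 1%:M.
have <- : \det X = \det (y%:M - A *m B).
  have: X *m block_mx 1%:M 0 (- B) 1%:M = block_mx (y%:M - A *m B) A 0 1%:M.
    by rewrite mulmx_block !mulmxN !mulmx1 !mulmx0 mul1mx subrr !add0r.
  move/(congr1 determinant); rewrite det_mulmx det_lblock det_ublock.
  by rewrite !det_scalar !expr1n !mulr1.
have: block_mx 1%:M 0 (- B) y%:M *m X = block_mx y%:M A 0 (y%:M - B *m A).
  rewrite mulmx_block !mul0mx !mul1mx !addr0 mulmx1 !mulNmx.
  by rewrite scalar_mxC addNr [- _ + _]addrC.
move/(congr1 determinant).
by rewrite det_mulmx det_lblock det_ublock !det_scalar expr1n mul1r.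
Qed.

(** A Schur complement with respect to the scalar block; scaling the first m columns by a avoids the
    inverse of a. *)
Lemma det_block_scalar (R : comPzRingType) m n (X : 'M[R]_m) (B : 'M[R]_(m, n))
    (D : 'M[R]_(n, m)) (a : R) :
  \det (block_mx X B D a%:M) * a ^+ m = \det (a *: X - B *m D) * a ^+ n.
Proof.
have: block_mx X B D a%:M *m block_mx a%:M 0 (- D) 1%:M
      = block_mx (a *: X - B *m D) B 0 a%:M.
  rewrite mulmx_block !mulmx0 !mulmx1 !add0r !mulmxN !mul_mx_scalar.
  by rewrite mul_scalar_mx subrr.
move/(congr1 determinant).
by rewrite det_mulmx det_lblock det_ublock !det_scalar expr1n mulr1.
Qed.

Lemma det_mx33 (R : comPzRingType) (a : nat -> nat -> R) :
  \det (\matrix_(i < 3, j < 3) a i j)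
  = a 0 0 * (a 1 1 * a 2 2 - a 1 2 * a 2 1)
    - a 0 1 * (a 1 0 * a 2 2 - a 1 2 * a 2 0)
    + a 0 2 * (a 1 0 * a 2 1 - a 1 1 * a 2 0).
Proof.
rewrite (expand_det_row _ 0) !big_ord_recl big_ord0 /cofactor.
rewrite !(expand_det_row _ 0) !big_ord_recl !big_ord0 /cofactor !det_mx11 !mxE.
rewrite /= /bump /= !(add0n, addn0, add1n).
ring.
Qed.

(** * Adjacency by classes and its low-rank factorization *)

(* The class (o, b) of a group element: o is the line spanned by its p-part, or
   None if that part is zero, and b tells whether its q-part is nonzero;
   reaches c d holds when the elements of class c are powers of those of
   class d. *)
Definition reaches (L : eqType) (c d : option L * bool) : bool :=
  ((c.1 == None) || (c.1 == d.1)) && (c.2 ==> d.2).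

Definition class_adj (L : eqType) (c d : option L * bool) : bool :=
  reaches L c d || reaches L d c.

Section Blowup.

(** In the application the four hypotheses concern the identity and the elements of order q, p and
    pq, the last two line by line: s = q - 1, t = p - 1, r = (p - 1)(q - 1). *)
Variables (T L : finType) (f : T -> option L * bool) (s t r : nat).
Hypothesis fiber0 : #|[set x | f x == (None, false)]| = 1%N.
Hypothesis fiberB : #|[set x | f x == (None, true)]| = s.
Hypothesis fiberA : forall l, #|[set x | f x == (Some l, false)]| = t.
Hypothesis fiberC : forall l, #|[set x | f x == (Some l, true)]| = r.

(** Turns the entries of [right_mx *m left_mx], sums over all vertices, into sums over classes
    weighted by their sizes. *)
Lemma sum_fibers (R : pzSemiRingType) (F : option L * bool -> R)
    (G : 'I_#|T| -> R) :
  (forall i, G i = F (f (enum_val i))) ->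
  \sum_i G i
  = F (None, false) + s%:R * F (None, true)
    + \sum_(l : L) (t%:R * F (Some l, false) + r%:R * F (Some l, true)).
Proof.
move=> FG; rewrite (eq_bigr _ (fun i _ => FG i)).
rewrite -(@big_enum_val _ _ _ _ T (fun x => F (f x))) /=.
have -> : \sum_(x in T) F (f x)
    = \sum_(o : option L) \sum_(b : bool) #|[set x | f x == (o, b)]|%:R * F (o, b).
  rewrite pair_bigA (partition_big f predT) //; apply: eq_bigr => -[o b] _.
  rewrite (eq_bigr (fun=> F (o, b))); last by move=> x /andP[_ /eqP->].
  by rewrite sumr_const mulr_natl cardsE; congr (_ *+ _); apply: eq_card.
rewrite (bigD1 None) //= big_bool /= fiber0 fiberB mul1r [X in X + _]addrC.
congr (_ + _); rewrite (reindex_omap Some id) => [|[l|]] //.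
apply: eq_big => [l|l _]; first by rewrite /= eqxx.
by rewrite big_bool /= fiberA fiberC addrC.
Qed.

Variable R : comPzRingType.
Implicit Type y : R.

Let k := #|L|.

(* With e, b and c_l the indicators of (None, false), (None, true) and
   (Some l, true), and u_l that of the two classes over l, the rows of the
   matrix of class_adj are 1 on e, e + b + sum_l c_l on b, e + b + u_l on c_l
   and e + u_l on (Some l, false). They are thus combinations, with
   coefficients left_sel and u_l, of 1, e + b + sum_l c_l, b and the e + u_l. *)
Definition left_sel (j : nat) (c : option L * bool) : bool :=
  nth false [:: c == (None, false); c == (None, true); (c.1 != None) && c.2] j.
Definition right_sel (j : nat) (c : option L * bool) : bool :=
  nth false [:: true; (c.1 == None) || c.2; c == (None, true)] j.

Lemma class_adj_factor c d :
  (class_adj L c d)%:R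
  = \sum_(j < 3) (left_sel j c)%:R * (right_sel j d)%:R
    + \sum_(l < k) (c.1 == Some (enum_val l))%:R
                   * ((d.1 == Some (enum_val l)) || (d == (None, false)))%:R :> R.
Proof.
rewrite -(@big_enum_val _ _ _ _ L (fun l => (c.1 == Some l)%:R
                   * ((d.1 == Some l) || (d == (None, false)))%:R)) /=.
rewrite !big_ord_recl big_ord0 /left_sel /right_sel /class_adj /reaches /=.
have SE (l m : L) : (Some l == Some m) = (l == m) by [].
case: c d => [[l|] b] [[m|] b'] /=.
- rewrite (bigD1 l) //= big1 => [|i /negPf ne]; last first.
    by rewrite SE eq_sym ne mul0r.
  rewrite !xpair_eqE !SE eqxx [m == l]eq_sym /=.
  by case: (l == m); case: b; case: b'; rewrite /=; ring.
- rewrite (bigD1 l) //= big1 => [|i /negPf ne]; last first.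
    by rewrite SE eq_sym ne mul0r.
  by rewrite !xpair_eqE !SE !eqxx; case: b; case: b'; rewrite /=; ring.
- rewrite big1 => [|i _]; last by rewrite mul0r.
  by rewrite !xpair_eqE; case: b; case: b'; rewrite /=; ring.
- rewrite big1 => [|i _]; last by rewrite mul0r.
  by rewrite !xpair_eqE; case: b; case: b'; rewrite /=; ring.
Qed.

Definition left_mx : 'M[R]_(#|T|, 3 + k) :=
  row_mx (\matrix_(i, j) (left_sel j (f (enum_val i)))%:R)
         (\matrix_(i, l) ((f (enum_val i)).1 == Some (enum_val l))%:R).

Definition right_mx : 'M[R]_(3 + k, #|T|) :=
  col_mx (\matrix_(j, i) (right_sel j (f (enum_val i)))%:R)
         (\matrix_(l, i) (((f (enum_val i)).1 == Some (enum_val l))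
                          || (f (enum_val i) == (None, false)))%:R).

Lemma blowup_factor :
  \matrix_(i, j) (class_adj L (f (enum_val i)) (f (enum_val j)))%:R
  = left_mx *m right_mx.
Proof.
rewrite /left_mx /right_mx mul_row_col; apply/matrixP => i j.
rewrite !mxE class_adj_factor; congr (_ + _); apply: eq_bigr => l _.
  by rewrite !mxE.
by rewrite !mxE.
Qed.

(** The block of the lines is scalar because the identity lies over no line: the entry at l and m
    counts the t + r elements over l if l = m, and is 0 otherwise. *)
Lemma gram_mx y :
  y%:M - right_mx *m left_mx
  = block_mx (\matrix_(i < 3, j < 3) ((i == j)%:R * y
              - nth 0 (nth [::] [:: [:: 1; s%:R; k%:R * r%:R];
                                   [:: 1; s%:R; k%:R * r%:R];
                                   [:: 0; s%:R; 0]] i) j))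
             (\matrix_(i < 3, l < k) - nth 0 [:: t%:R + r%:R; r%:R; 0] i)
             (\matrix_(l < k, j < 3) - nth 0 [:: 1; 0; r%:R] j)
             (y - (t%:R + r%:R))%:M.
Proof.
have SE (l m : L) : (Some l == Some m) = (l == m) by [].
have sumE (c : R) : \sum_(l : L) c = k%:R * c by rewrite sumr_const mulr_natl.
rewrite /left_mx /right_mx mul_col_row scalar_mx_block opp_block_mx add_block_mx.
congr block_mx; apply/matrixP => i j; rewrite !mxE.
- rewrite (sum_fibers _ (fun c => (right_sel i c)%:R * (left_sel j c)%:R));
    last by move=> x; rewrite !mxE.
  case: i j => [[|[|[|i]]] ?] [[|[|[|j]]] ?] //;
    rewrite /= /right_sel /left_sel /= ?xpair_eqE /= sumE; ring.
- rewrite (sum_fibers _ (fun c => (right_sel i c)%:R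
                                * (c.1 == Some (enum_val j))%:R));
    last by move=> x; rewrite !mxE.
  rewrite (bigD1 (enum_val j)) //= big1 ?eqxx => [|l /negPf ne]; last first.
    by rewrite SE ne /=; ring.
  by case: i => [[|[|[|i]]] ?] //=; ring.
- rewrite (sum_fibers _ (fun c => ((c.1 == Some (enum_val i))
                                || (c == (None, false)))%:R * (left_sel j c)%:R));
    last by move=> x; rewrite !mxE.
  rewrite (bigD1 (enum_val i)) //= big1 ?eqxx => [|l /negPf ne]; last first.
    by rewrite SE ne !xpair_eqE /=; ring.
  by case: j => [[|[|[|j]]] ?] //=; ring.
- rewrite (sum_fibers _ (fun c => ((c.1 == Some (enum_val i))
              || (c == (None, false)))%:R * (c.1 == Some (enum_val j))%:R));
    last by move=> x; rewrite !mxE.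
  rewrite (bigD1 (enum_val i)) //= big1 ?eqxx => [|l /negPf ne]; last first.
    by rewrite !SE ne !xpair_eqE /=; ring.
  by rewrite SE (inj_eq enum_val_inj); case: (i == j); rewrite /=; ring.
Qed.

End Blowup.

(** * Reduction to a 3 x 3 determinant *)

(** A ring expression, so that [ring] can expand it and x may be the indeterminate itself. *)
Definition quartic_at {R : pzRingType} (p q x : R) : R :=
  - x ^+ 4 + (p * q - 4) * x ^+ 3
  + (p ^+ 2 * q ^+ 2 - p ^+ 2 * q - p * q ^+ 2 + 3 * p * q + p ^+ 2 + q - 7)
      * x ^+ 2
  + (- p ^+ 3 * (q - 1) ^+ 2 + 3 * p ^+ 2 * q ^+ 2 - 5 * p ^+ 2 * q
     - p * q ^+ 2 + 4 * p ^+ 2 - q ^+ 2 + p * q + p + 5 * q - 8) * x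
  + (- p ^+ 4 * (q - 1) ^+ 2 + 3 * p ^+ 2 * q ^+ 2 - 6 * p ^+ 2 * q
     - p * q ^+ 2 + p * q + 4 * p ^+ 2 - q ^+ 2 + 4 * q - 4).

Lemma det_blowup (R : idomainType) (T L : finType) (f : T -> option L * bool)
    (p q : nat) (x : R) :
    (0 < p)%N -> (0 < q)%N -> #|L| = p.+1 ->
    #|[set z | f z == (None, false)]| = 1%N ->
    #|[set z | f z == (None, true)]| = q.-1 ->
    (forall l, #|[set z | f z == (Some l, false)]| = p.-1) ->
    (forall l, #|[set z | f z == (Some l, true)]| = (p.-1 * q.-1)%N) ->
    x + 1 - (p%:R - 1) * q%:R != 0 ->
  \det ((x + 1)%:M
        - \matrix_(i < #|T|, j < #|T|)
            (class_adj L (f (enum_val i)) (f (enum_val j)))%:R)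
    * (x + 1) ^+ (p + 4)
  = (x + 1) ^+ #|T| * (x + 1 - (p%:R - 1) * q%:R) ^+ p
    * - quartic_at p%:R q%:R x.
Proof.
move=> p0 q0 cardL f0 fB fA fC a0.
rewrite blowup_factor; set a := _ - _ * q%:R in a0 *.
rewrite mulrC (_ : p + 4 = 3 + #|L|)%N; last by rewrite cardL addnC addSnnS.
rewrite det_scalar_sub_mulmxC -mulrA; congr (_ * _).
(* The Schur complement costs a^3 and yields a^(p+1); with a^2 from the 3 x 3 determinant, a^p
   remains. *)
apply: (mulIf (expf_neq0 3 a0)).
rewrite (gram_mx _ _ _ _ _ _ f0 fB fA fC).
have E n : (0 < n)%N -> n.-1%:R = n%:R - 1 :> R.
  by case: n => // n _; rewrite -natr1 addrK.
rewrite natrM cardL -natr1 !E //.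
(* Over each line, t + r = (p - 1) + (p - 1)(q - 1) = (p - 1) q. *)
rewrite (_ : x + 1 - _ = a); last by rewrite /a; ring.
rewrite det_block_scalar.
set P : R := p%:R; set Q : R := q%:R.
(* The off-diagonal blocks are constant along the p + 1 lines, so their product is P + 1 times a
   column times a row. *)
pose B i j := a * ((i == j)%:R * (x + 1)
   - nth 0 (nth [::] [:: [:: 1; Q - 1; (P + 1) * ((P - 1) * (Q - 1))];
                         [:: 1; Q - 1; (P + 1) * ((P - 1) * (Q - 1))];
                         [:: 0; Q - 1; 0]] i) j)
  - (P + 1) * (nth 0 [:: P - 1 + (P - 1) * (Q - 1); (P - 1) * (Q - 1); 0] i
               * nth 0 [:: 1; 0; (P - 1) * (Q - 1)] j).
rewrite (_ : _ - _ = \matrix_(i < 3, j < 3) B i j); last first.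
  apply/matrixP => i j; rewrite !mxE; congr (_ - _).
  rewrite (eq_bigr (fun=>
      nth 0 [:: P - 1 + (P - 1) * (Q - 1); (P - 1) * (Q - 1); 0] i
      * nth 0 [:: 1; 0; (P - 1) * (Q - 1)] j)) => [|l _]; last first.
    by rewrite !mxE mulrNN.
  by rewrite sumr_const card_ord -mulr_natl -natr1.
(* The factor a^2 appears because [B] is a times a matrix, minus a matrix of rank at most one. *)
suff -> : \det (\matrix_(i < 3, j < 3) B i j) = a ^+ 2 * - quartic_at P Q x.
  by rewrite (exprS a p); move: (a ^+ p) (quartic_at _ _ _) => b c; ring.
rewrite det_mx33 /B /= /quartic_at /a -/P -/Q.
ring.
Qed.

(** * Lines of the plane and the classes of points *)

(* The inner None is the vertical line. *)
Definition slope {F : fieldType} (v : F * F) : option (option F) :=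
  if v == 0 then None else Some (if v.1 == 0 then None else Some (v.2 / v.1)).

Lemma slope_eq0 (F : fieldType) (v : F * F) : (slope v == None) = (v == 0).
Proof. by rewrite /slope; case: ifP. Qed.

Lemma slopeP (F : fieldType) (v w : F * F) :
  reflect (exists a, v = (a * w.1, a * w.2))
          ((slope v == None) || (slope v == slope w)).
Proof.
rewrite slope_eq0 /slope.
have [->|v0] := eqVneq v 0; first by constructor; exists 0; rewrite !mul0r.
have [->|w0] /= := eqVneq w 0.
  by constructor=> -[a va]; case/eqP: v0; rewrite va /= !mulr0.
case: v w v0 w0 => [v1 v2] [w1 w2]; rewrite -!pair_eqE /pair_eq /= => v0 w0.
apply: (iffP eqP) => [|[a [ev1 ev2]]].
- have [v10|v10] := eqVneq v1 0; have [w10|w10] := eqVneq w1 0 => //.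
    rewrite w10 eqxx /= in w0 => _.
    by exists (v2 / w2); rewrite v10 w10 mulr0 mulfVK.
  case=> /(canRL (mulfVK v10)) ->.
  by exists (v1 / w1); rewrite mulfVK //; congr (_, _); field.
- have a0 : a != 0 by apply: contraNneq v0 => a0; rewrite ev1 ev2 a0 !mul0r eqxx.
  rewrite ev1 ev2 mulf_eq0 (negPf a0) /=.
  by case: eqP => // w10; rewrite -mulf_div divff // mul1r.
Qed.

(** The nonzero multiples of a direction vector [d] run through the fiber without repetition. *)
Lemma card_slope_fiber (F : finFieldType) (l : option F) :
  #|[set v : F * F | slope v == Some l]| = #|F|.-1.
Proof.
pose d : F * F := if l is Some m then (1, m) else (0, 1).
rewrite -(cardsC1 (0 : F)).
rewrite -(card_imset _ (_ : injective (fun a => (a * d.1, a * d.2)))).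
  apply: eq_card => v; rewrite inE; apply/idP/imsetP => [|[a]].
    case: v => v1 v2; rewrite /slope -pair_eqE /pair_eq /= /d.
    have [->|v10] := eqVneq v1 0 => /=; last first.
      by move=> /eqP[<-]; exists v1; rewrite ?inE //= mulr1 mulrC divfK.
    have [//|v20 /eqP[<-]] := eqVneq v2 0.
    by exists v2; rewrite ?inE //= mulr0 mulr1.
  rewrite !inE => a0 ->; rewrite /slope -pair_eqE /pair_eq /=.
  rewrite /d; case: (l) => [m|] /=; rewrite ?mulr1 ?mulr0 (negPf a0) ?eqxx //=.
  by rewrite mulrAC divff ?mul1r.
by rewrite /d => a b []; case: (l) => [m|] /=; rewrite !mulr1.
Qed.

Definition point_class {F K : fieldType} (z : F * F * K) :
  option (option F) * bool := (slope z.1, z.2 != 0).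

(** The line condition provides a and the condition on q-parts provides b, independently; the
    Chinese remainder theorem later merges them into one exponent. *)
Lemma reaches_pointP (F K : fieldType) (z w : F * F * K) :
  reflect (exists a b, z = (a * w.1.1, a * w.1.2, b * w.2))
          (reaches _ (point_class z) (point_class w)).
Proof.
rewrite /reaches /=; apply: (iffP andP) => [[/slopeP[a e] h]|[a [b ->]]].
  exists a; have [b eb] : exists b, z.2 = b * w.2; last first.
    by exists b; rewrite -e -eb; case: (z).
  have [w0|w0] := eqVneq w.2 0; last by exists (z.2 / w.2); rewrite divfK.
  by exists 0; apply/eqP; move: h; rewrite w0 eqxx mul0r implybF negbK.
split; first by apply/slopeP; exists a.
by apply/implyP; apply: contraNneq => /= ->; rewrite mulr0.
Qed.

Lemma card_point_class (F K : finFieldType) (o : option (option F)) (b : bool) :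
  #|[set z : F * F * K | point_class z == (o, b)]|
  = ((if o is Some _ then #|F|.-1 else 1) * (if b then #|K|.-1 else 1))%N.
Proof.
rewrite (_ : [set _ | _]
             = setX [set v | slope v == o] [set w : K | (w != 0) == b]).
  rewrite cardsX; congr (_ * _)%N.
    case: o => [l|]; first exact: card_slope_fiber.
    by rewrite -(cards1 (0 : F * F)); apply: eq_card => v; rewrite !inE slope_eq0.
  case: b.
    by rewrite -(cardsC1 (0 : K)); apply: eq_card => w; rewrite !inE eqb_id.
  by rewrite -(cards1 (0 : K)); apply: eq_card => w; rewrite !inE eqbF_neg negbK.
by apply/setP=> z; rewrite !inE xpair_eqE.
Qed.

(** * Coordinates of the group over prime fields *)

Lemma natr_modF r n d : prime r -> (r %| d)%N -> (n %% d)%:R = n%:R :> 'F_r.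
Proof.
move=> pr rd; rewrite [in RHS](divn_eq n d) natrD natrM.
rewrite (_ : d%:R = 0) ?mulr0 ?add0r //.
by apply/eqP; rewrite -(dvdn_pcharf (pchar_Fp pr)).
Qed.

Lemma natF_eq r m n : prime r -> (m%:R == n%:R :> 'F_r) = (m == n %[mod r]).
Proof. by move=> pr; rewrite -val_eqE /= !val_Fp_nat. Qed.

Lemma natF_mulrn r n (a : 'Z_n) k : prime r -> (1 < n)%N -> (r %| n)%N ->
  ((a *+ k)%R : nat)%:R = (a : nat)%:R *+ k :> 'F_r.
Proof.
move=> pr n1 rn; have -> : (a *+ k)%R = (a * k %% n)%N :> nat.
  by rewrite Zp_mulrn /=; congr (_ %% _)%N; rewrite Zp_cast.
by rewrite natr_modF // natrM mulr_natr.
Qed.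

Section Coords.

Variables p q : nat.
Hypotheses (hp : prime p) (hq : prime q) (hpq : p != q).

Let pq1 : (1 < p * q)%N.
Proof. by rewrite (leq_trans (prime_gt1 hp)) // leq_pmulr // prime_gt0. Qed.

Let co_pq : coprime p q.
Proof. by rewrite prime_coprime // dvdn_prime2. Qed.

Notation G := ('Z_p * 'Z_(p * q))%type.

(** The second component is split by the Chinese remainder theorem; the two residues modulo p form
    the p-part. *)
Definition coords (x : G) : 'F_p * 'F_p * 'F_q :=
  ((x.1 : nat)%:R, (x.2 : nat)%:R, (x.2 : nat)%:R).

Lemma coordsX x k :
  coords (x ^+ k)%g
  = ((coords x).1.1 *+ k, (coords x).1.2 *+ k, (coords x).2 *+ k).
Proof.
have -> : (x ^+ k)%g = (x.1 *+ k, x.2 *+ k).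
  by elim: k => [|k IH]; rewrite ?expg0 // expgS IH !mulrS.
by rewrite /coords !natF_mulrn ?pq1 ?prime_gt1 ?(dvdn_mulr q (dvdnn p))
           ?(dvdn_mull p (dvdnn q)) ?dvdnn.
Qed.

Lemma coords_inj : injective coords.
Proof.
move=> [a b] [c d] [/eqP + /eqP + /eqP]; rewrite !natF_eq // => ac bdp bdq.
have ltZ n (z : 'Z_n) : (1 < n)%N -> (z < n)%N.
  by move=> n1; rewrite (leq_trans (ltn_ord z)) // Zp_cast.
have {ac}-> : a = c.
  by apply/val_inj; move/eqP: ac; rewrite !modn_small // ltZ ?prime_gt1.
congr (_, _); apply/val_inj/eqP => /=.
have := chinese_remainder co_pq b d; rewrite bdp bdq.
by rewrite !modn_small ?ltZ.
Qed.

Lemma coords_bij : bijective coords.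
Proof.
apply: inj_card_bij; first exact: coords_inj.
rewrite !card_prod !card_Fp // !card_ord.
by rewrite (Zp_cast (prime_gt1 hp)) (Zp_cast pq1) mulnA.
Qed.

Lemma powerP (x y : G) :
  reflect (exists k : nat, x = (y ^+ k)%g)
          (reaches _ (point_class (coords x)) (point_class (coords y))).
Proof.
apply: (iffP (reaches_pointP _ _ _ _)) => [[a [b e]]|[k ->]]; last first.
  by exists k%:R, k%:R; rewrite coordsX !mulr_natl.
(* An exponent congruent to a modulo p and to b modulo q. *)
exists (chinese p q a b); apply: coords_inj; rewrite coordsX e.
rewrite -[_.1.1 *+ _]mulr_natl -[_.1.2 *+ _]mulr_natl -[_.2 *+ _]mulr_natl.
have -> : (chinese p q a b)%:R = a.
  by apply/eqP; rewrite -[X in _ == X]natr_Zp natF_eq // chinese_modl.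
have -> // : (chinese p q a b)%:R = b.
by apply/eqP; rewrite -[X in _ == X]natr_Zp natF_eq // chinese_modr.
Qed.

(** As [class_adj] is reflexive, it describes A + 1 rather than A. *)
Lemma power_graph_coords (x y : G) :
  class_adj _ (point_class (coords x)) (point_class (coords y))
  = @power_graph G x y || (x == y).
Proof.
rewrite /power_graph /class_adj orbC.
have [->|xy] := eqVneq; first by rewrite (introT (powerP _ _)) //; exists 1%N.
rewrite orbF /=; apply/orP/asboolP => [[/powerP|/powerP]|[/powerP|/powerP]];
  by [left | right].
Qed.

Lemma card_coords_class (o : option (option 'F_p)) (b : bool) :
  #|[set x | point_class (coords x) == (o, b)]|
  = ((if o is Some _ then p.-1 else 1) * (if b then q.-1 else 1))%N.
Proof.
have := card_point_class _ 'F_q o b; rewrite !card_Fp // => <-.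
rewrite -(on_card_preimset (onW_bij _ coords_bij)).
by apply: eq_card => x; rewrite !inE.
Qed.

End Coords.

(** * Characteristic polynomial and spectrum *)

(** The order of [poly_roots] is unspecified; unique factorization into linear factors determines it
    up to permutation. *)
Lemma poly_roots_perm (C : closedFieldType) (P : {poly C}) (c : C) (s : seq C) :
  P != 0 -> P = c *: \prod_(z <- s) ('X - z%:P) -> perm_eq (poly_roots P) s.
Proof.
move=> P0 Pcs; have lP : lead_coef P = c.
  by rewrite Pcs lead_coefZ (monicP (monic_prod_XsubC _ _ _)) mulr1.
apply: prod_XsubC_eq; have := poly_rootsE P; rewrite lP [in LHS]Pcs.
by move/scalerI => -> //; rewrite -lP lead_coef_eq0.
Qed.

Lemma quartic_polyE (R : comNzRingType) (p q : nat) :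
  quartic (p%:R : R) q%:R = quartic_at p%:R q%:R 'X.
Proof.
rewrite /quartic /quartic_at -!mul_polyC -!(polyC_natr).
by rewrite !(polyCD, polyCM, polyCB, polyCN, polyC_exp).
Qed.

Lemma char_poly_power_graph (R : idomainType) (p q : nat) :
    prime p -> prime q -> p != q ->
  char_poly (adjacency_matrix R (@power_graph ('Z_p * 'Z_(p * q))%type))
    * ('X + 1) ^+ (p + 4)
  = ('X + 1) ^+ (p ^ 2 * q) * ('X + 1 - (p%:R - 1) * q%:R) ^+ p
    * - quartic p%:R q%:R.
Proof.
move=> hp hq hpq.
have cardG : #|{: 'Z_p * 'Z_(p * q)}| = (p ^ 2 * q)%N.
  by rewrite (bij_eq_card (coords_bij _ _ hp hq hpq)) !card_prod !card_Fp.
have cardL : #|{: option 'F_p}| = p.+1 by rewrite card_option card_Fp.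
have cards := card_coords_class _ _ hp hq hpq.
have X1 : 'X + 1 - (p%:R - 1) * q%:R != 0 :> {poly R}.
  rewrite -!polyC_natr -polyC1 -polyCB -polyCM -addrA -polyCB -[_%:P]opprK -polyCN.
  by rewrite polyXsubC_eq0.
rewrite quartic_polyE -cardG.
rewrite -(det_blowup _ _ _ (fun x => point_class (coords p q x)) p q 'X) //.
(* Entrywise, X - A = (X + 1) - (A + 1). *)
- congr (\det _ * _); apply/matrixP => i j; rewrite !mxE.
  rewrite (power_graph_coords _ _ hp hq hpq) (inj_eq enum_val_inj).
  have [->|ij] := eqVneq i j.
    by rewrite power_graph_irrefl /= subr0 addrK.
  by rewrite orbF !mulr0n polyC_natr.
- exact: prime_gt0.
- exact: prime_gt0.
- by rewrite (cards None true) mul1n.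
- by move=> l; rewrite (cards (Some l) false) muln1.
Qed.

Theorem theorem4p1 (C : numClosedFieldType) (p q : nat)
    (hp : prime p) (hq : prime q) (hpq : p != q) :
  perm_eq
    (graph_spectrum C (@power_graph ('Z_p * 'Z_(p * q))%type))
    (nseq (p ^ 2 * q - p - 4)%N (-1)
     ++ nseq p ((p%:R - 1) * q%:R - 1)
     ++ poly_roots (quartic (p%:R : C) q%:R)).
Proof.
rewrite /graph_spectrum; set N := (p ^ 2 * q - p - 4)%N.
set A := adjacency_matrix _ _.
(* Any constant suits [poly_roots_perm], so the leading coefficient stays symbolic. *)
have E : char_poly A = - lead_coef (quartic (p%:R : C) q%:R) *:
  \prod_(z <- nseq N (-1) ++ nseq p ((p%:R - 1) * q%:R - 1)
               ++ poly_roots (quartic (p%:R : C) q%:R)) ('X - z%:P).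
  have X1 : 'X + 1 != 0 :> {poly C} by rewrite -[1]opprK -polyCN polyXsubC_eq0.
  apply: (mulIf (expf_neq0 (p + 4) X1)); rewrite char_poly_power_graph //.
  rewrite !big_cat /= !big_nseq.
  (* The subtraction in [N] is not truncated, since p + 4 <= p^2 q. *)
  have -> : (p ^ 2 * q)%N = (N + (p + 4))%N.
    rewrite /N -subnDA subnK //.
    have [p1 q1] := (prime_gt1 hp, prime_gt1 hq).
    have [p2|p3] := leqP p 2; last by rewrite expnS expn1; nia.
    by move: hpq p2; rewrite expnS expn1; nia.
  have -> : 'X - (-1)%:P = 'X + 1 :> {poly C} by rewrite polyCN opprK.
  have -> : 'X - ((p%:R - 1) * q%:R - 1)%:P
            = 'X + 1 - (p%:R - 1) * q%:R :> {poly C}.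
    by rewrite !polyCB polyCM polyCB !polyC_natr; ring.
  set Q := quartic _ _.
  rewrite !iter_mulr_1 [in LHS](poly_rootsE Q) exprD -!mul_polyC polyCN.
  ring.
apply: poly_roots_perm E; exact: monic_neq0 (char_poly_monic _).
Qed.
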